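(* (i) Every commutative ring which is a principal ideal domain is a multiplication ring. (ii) Every factor (quotient) ring of a principal ideal domain is a multiplication ring. (iii) Every finite commutative unitary ring of the form $A=\mathbb{Z}_{k_1}\times\mathbb{Z}_{k_2}\times\dots\times\mathbb{Z}_{k_r}$ (direct product of rings with componentwise operations), where $k_i=p_i^{\alpha_i}$ with $p_i$ a prime number and $\alpha_i$ a positive integer for each $i\in\{1,\dots,r\}$, is a multiplication ring.
   Context: For ideals $I,J$ of a commutative unitary ring $A$, $I\otimes J=\{\sum_{k=1}^n i_kj_k : i_k\in I, j_k\in J\}$ is the product ideal. An ideal $I$ of $A$ is a multiplication ideal if for every ideal $J\subseteq I$ there exists an ideal $K$ of $A$ such that $J=I\otimes K$. The ring $A$ is a multiplication ring if all its ideals are multiplication ideals. $\mathbb{Z}_k$ denotes $\mathbb{Z}/k\mathbb{Z}$; the primes $p_i$ need not be distinct. *)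

(* Defs.v *)
From HB Require Import structures.
From mathcomp Require Import all_boot all_order all_algebra.
From mathcomp Require Import boolp classical_sets.

Set Implicit Arguments.
Unset Strict Implicit.
Unset Printing Implicit Defensive.

Import GRing.Theory.
Local Open Scope classical_set_scope.
Local Open Scope ring_scope.
Local Open Scope quotient_scope.

(* [idealr] of ring_quotient only covers proper ideals; the whole ring must be
   allowed here, so ideals are bundled anew, over possibly zero rings. *)
Record ideal (A : comPzRingType) := Ideal {
  ideal_set :> set A;
  ideal0 : ideal_set 0;
  idealD : forall x y, ideal_set x -> ideal_set y -> ideal_set (x + y);
  idealMl : forall a x, ideal_set x -> ideal_set (a * x)
}.

(* [n.+1] because sums run over k = 1, ..., n with n >= 1. *)
Definition ideal_prod (A : comPzRingType) (I J : ideal A) : set A :=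
  [set x | exists (n : nat) (i j : 'I_n.+1 -> A),
    [/\ forall k, ideal_set I (i k), forall k, ideal_set J (j k) & x = \sum_(k < n.+1) i k * j k]].

Definition multiplication_ideal (A : comPzRingType) (I : ideal A) : Prop :=
  forall J : ideal A, J `<=` I ->
    exists K : ideal A, J = ideal_prod I K :> set A.

Definition multiplication_ring (A : comPzRingType) : Prop :=
  forall I : ideal A, multiplication_ideal I.

Definition principal_ideal_domain (R : idomainType) : Prop :=
  forall I : ideal R, exists a : R, I = [set r * a | r in setT] :> set R.

(* The quotient A / I, for any ideal I (A / A being the zero ring): the
   additive quotient is [Quotient.quot] of ring_quotient, whose multiplication
   is only provided there for proper ideals. *)
Section QuotientRing.
Variables (A : comPzRingType) (I : ideal A).

Definition ideal_pred : {pred A} := fun x => `[< ideal_set I x >].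

Lemma ideal_predE x : (x \in ideal_pred) = `[< ideal_set I x >].
Proof. by []. Qed.

Lemma idealB x y :
  ideal_set I x -> ideal_set I y -> ideal_set I (x - y).
Proof. by move=> Ix Iy; apply: idealD => //; rewrite -mulN1r; apply: idealMl. Qed.

Lemma ideal_pred_zmod_closed : zmod_closed ideal_pred.
Proof.
split=> [|x y]; first by rewrite ideal_predE; apply/asboolP/ideal0.
by rewrite !ideal_predE => /asboolP Ix /asboolP Iy; apply/asboolP/idealB.
Qed.

HB.instance Definition _ :=
  GRing.isZmodClosed.Build A ideal_pred ideal_pred_zmod_closed.

Definition quotient_ring : Type := @Quotient.quot A ideal_pred.

HB.instance Definition _ := GRing.Zmodule.on quotient_ring.
HB.instance Definition _ := EqQuotient.on quotient_ring.

Definition quotient_one : quotient_ring := \pi_quotient_ring 1.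
Definition quotient_mul : quotient_ring -> quotient_ring -> quotient_ring :=
  lift_op2 quotient_ring *%R.

Lemma quotient_piE x y :
  (\pi_quotient_ring x = \pi_quotient_ring y) <-> ideal_set I (x - y).
Proof.
split=> [|/asboolP Ixy]; last first.
  by apply/eqP; rewrite -(@Quotient.idealrBE A ideal_pred).
by move/eqP; rewrite -(@Quotient.idealrBE A ideal_pred) => /asboolP.
Qed.

Lemma quotient_pi_add x y :
  \pi_quotient_ring (x + y) = \pi_quotient_ring x + \pi_quotient_ring y.
Proof. exact: (@Quotient.pi_add A ideal_pred). Qed.

Lemma quotient_pi_mul x y : \pi_quotient_ring (x * y)
  = quotient_mul (\pi_quotient_ring x) (\pi_quotient_ring y).
Proof.
rewrite /quotient_mul; unlock; apply/quotient_piE.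
set x' := repr _; set y' := repr _.
have Ix : ideal_set I (x - x') by apply/quotient_piE; rewrite reprK.
have Iy : ideal_set I (y - y') by apply/quotient_piE; rewrite reprK.
have -> : x * y - x' * y' = y * (x - x') + x' * (y - y').
  by rewrite !mulrBr (mulrC y x) (mulrC y x') addrA subrK.
by apply: idealD; apply: idealMl.
Qed.

Lemma quotient_mulA : associative quotient_mul.
Proof.
by move=> x y z; rewrite -[x]reprK -[y]reprK -[z]reprK -!quotient_pi_mul mulrA.
Qed.

Lemma quotient_mulC : commutative quotient_mul.
Proof. by move=> x y; rewrite -[x]reprK -[y]reprK -!quotient_pi_mul mulrC. Qed.

Lemma quotient_mul1 : left_id quotient_one quotient_mul.
Proof. by move=> x; rewrite -[x]reprK -quotient_pi_mul mul1r. Qed.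

Lemma quotient_mulDl : left_distributive quotient_mul +%R.
Proof.
move=> x y z; rewrite -[x]reprK -[y]reprK -[z]reprK.
by rewrite -quotient_pi_add -!quotient_pi_mul -quotient_pi_add mulrDl.
Qed.

HB.instance Definition _ := GRing.Zmodule_isComPzRing.Build quotient_ring
  quotient_mulA quotient_mulC quotient_mul1 quotient_mulDl.

End QuotientRing.

Section ProductRing.
Variables (r : nat) (A : 'I_r -> comPzRingType).

Definition product_ring : Type := {dffun forall i : 'I_r, A i}.

HB.instance Definition _ := Choice.on product_ring.

Implicit Types x y z : product_ring.

Definition product_zero : product_ring := [ffun i => (0 : A i)].
Definition product_opp x : product_ring := [ffun i => - x i].
Definition product_add x y : product_ring := [ffun i => x i + y i].
Definition product_one : product_ring := [ffun i => (1 : A i)].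
Definition product_mul x y : product_ring := [ffun i => x i * y i].

Lemma product_addA : associative product_add.
Proof. by move=> x y z; apply/ffunP => i; rewrite !ffunE addrA. Qed.
Lemma product_addC : commutative product_add.
Proof. by move=> x y; apply/ffunP => i; rewrite !ffunE addrC. Qed.
Lemma product_add0 : left_id product_zero product_add.
Proof. by move=> x; apply/ffunP => i; rewrite !ffunE add0r. Qed.
Lemma product_addN : left_inverse product_zero product_opp product_add.
Proof. by move=> x; apply/ffunP => i; rewrite !ffunE addNr. Qed.

HB.instance Definition _ := GRing.isZmodule.Build product_ring
  product_addA product_addC product_add0 product_addN.

Lemma product_mulA : associative product_mul.
Proof. by move=> x y z; apply/ffunP => i; rewrite !ffunE mulrA. Qed.
Lemma product_mulC : commutative product_mul.
Proof. by move=> x y; apply/ffunP => i; rewrite !ffunE mulrC. Qed.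
Lemma product_mul1 : left_id product_one product_mul.
Proof. by move=> x; apply/ffunP => i; rewrite !ffunE mul1r. Qed.
Lemma product_mulDl : left_distributive product_mul product_add.
Proof. by move=> x y z; apply/ffunP => i; rewrite !ffunE mulrDl. Qed.

HB.instance Definition _ := GRing.Zmodule_isComPzRing.Build product_ring
  product_mulA product_mulC product_mul1 product_mulDl.

End ProductRing.

(* Main.v *)
Require Import Defs.
From HB Require Import structures.
From mathcomp Require Import all_boot all_order all_algebra.
From mathcomp Require Import boolp classical_sets.

(** Everything reduces to one fact: a commutative ring all of whose ideals are
    principal is a multiplication ring.  Indeed, if J is contained in I = (a),
    every element of J is a multiple of a, so J = (a) K where K = (J : a) is the
    ideal of all x with x a in J ([principal_ring_multiplication]).

    It remains to see that the three kinds of rings are principal.  A principal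
    ideal domain is so by definition.  Principality passes to homomorphic images
    ([principal_ring_surj]), hence to quotients: lift an ideal to its preimage
    and project a generator.  It also passes to finite direct products
    ([principal_ring_product]), because the idempotents of a product allow
    generators of the projections of an ideal to be glued into one of its
    elements.  Finally the rings of integers modulo n are principal by Euclidean
    division ([principal_ring_Zp]). *)

Set Implicit Arguments.
Unset Strict Implicit.
Unset Printing Implicit Defensive.

Import GRing.Theory.
Local Open Scope classical_set_scope.
Local Open Scope ring_scope.
Local Open Scope quotient_scope.

(** Zero divisors are allowed, unlike in [principal_ideal_domain], so that the
    notion applies to quotients and products. *)
Definition principal_ring (A : comPzRingType) : Prop :=
  forall I : ideal A, exists a : A, I = [set r * a | r in setT] :> set A.

Lemma ideal_sum (A : comPzRingType) (I : ideal A) (T : finType) (F : T -> A) :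
  (forall k, ideal_set I (F k)) -> ideal_set I (\sum_k F k).
Proof.
move=> IF; apply: (big_ind (ideal_set I)) => //; first exact: ideal0.
exact: idealD.
Qed.

Lemma principal_ring_intro (A : comPzRingType) :
  (forall I : ideal A, exists2 a : A,
     ideal_set I a & forall x, ideal_set I x -> exists r, x = r * a) ->
  principal_ring A.
Proof.
move=> genA I; have [a Ia gen_a] := genA I; exists a; apply/seteqP; split=> x.
  by move=> /gen_a[r ->]; exists r.
by move=> [r _ <-]; apply: idealMl.
Qed.

Lemma principal_ring_gen (A : comPzRingType) (I : ideal A) :
  principal_ring A -> exists2 a : A,
    ideal_set I a & forall x, ideal_set I x -> exists r, x = r * a.
Proof.
move=> prA; have [a defI] := prA I; exists a.
  by rewrite defI; exists 1; rewrite ?mul1r.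
by move=> x; rewrite defI => -[r _ <-]; exists r.
Qed.

(** * Principal rings are multiplication rings *)

Section Colon.
Variables (A : comPzRingType) (J : ideal A) (a : A).

Definition colon_set : set A := [set x | ideal_set J (x * a)].

Lemma colon0 : colon_set 0.
Proof. by rewrite /colon_set /= mul0r; apply: ideal0. Qed.

Lemma colonD x y : colon_set x -> colon_set y -> colon_set (x + y).
Proof. by rewrite /colon_set /= mulrDl; apply: idealD. Qed.

Lemma colonMl b x : colon_set x -> colon_set (b * x).
Proof. by rewrite /colon_set /= -mulrA; apply: idealMl. Qed.

Definition colon : ideal A := Ideal colon0 colonD colonMl.

End Colon.

(** If J lies in I = (a), the cofactor is (J : a): whenever r a lies in J, r lies
    in (J : a) by definition. *)
Lemma principal_ring_multiplication (A : comPzRingType) :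
  principal_ring A -> multiplication_ring A.
Proof.
move=> prA I J sJI; have [a Ia gen_a] := principal_ring_gen I prA.
exists (colon J a); apply/seteqP; split=> x.
  move=> Jx; have [r def_x] := gen_a x (sJI x Jx).
  exists 0%N, (fun=> a), (fun=> r); split=> // [_|].
    by rewrite /= /colon_set /= -def_x.
  by rewrite big_ord1 mulrC.
move=> [n [i [j [Ii Kj ->]]]]; apply: ideal_sum => k.
have [r ->] := gen_a _ (Ii k).
by rewrite -mulrA; apply: idealMl; rewrite mulrC; apply: Kj.
Qed.

(** * Images and products of principal rings *)

Section Preimage.
Variables (A B : comPzRingType) (f : A -> B).
Hypothesis fD : {morph f : x y / x + y}.
Hypothesis fM : {morph f : x y / x * y}.
Variable I : ideal B.

Lemma preimage_ideal0 : (f @^-1` I) 0.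
Proof.
have f0 : f 0 = 0 by apply: (addIr (f 0)); rewrite -fD !add0r.
by rewrite /= f0; apply: ideal0.
Qed.

Lemma preimage_idealD x y :
  (f @^-1` I) x -> (f @^-1` I) y -> (f @^-1` I) (x + y).
Proof. by rewrite /= fD; apply: idealD. Qed.

Lemma preimage_idealMl a x : (f @^-1` I) x -> (f @^-1` I) (a * x).
Proof. by rewrite /= fM; apply: idealMl. Qed.

Definition preimage_ideal : ideal A :=
  Ideal preimage_ideal0 preimage_idealD preimage_idealMl.

End Preimage.

Lemma principal_ring_surj (A B : comPzRingType) (f : A -> B) :
  {morph f : x y / x + y} -> {morph f : x y / x * y} ->
  (forall y, exists x, f x = y) -> principal_ring A -> principal_ring B.
Proof.
move=> fD fM f_surj prA; apply: principal_ring_intro => I.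
have [a Ia gen_a] := principal_ring_gen (preimage_ideal fD fM I) prA.
exists (f a) => // y Iy; have [x fx] := f_surj y; rewrite -fx in Iy *.
by have [r ->] := gen_a x Iy; exists (f r); rewrite fM.
Qed.

Lemma principal_ring_quotient (A : comPzRingType) (I : ideal A) :
  principal_ring A -> principal_ring (quotient_ring I).
Proof.
apply: (@principal_ring_surj A (quotient_ring I) \pi_(quotient_ring I)).
- exact: quotient_pi_add.
- exact: quotient_pi_mul.
- by move=> y; exists (repr y); rewrite reprK.
Qed.

Definition inject (r : nat) (A : 'I_r -> comPzRingType) (i : 'I_r) (a : A i) :
    product_ring A :=
  [ffun j => dfwith (fun k => 0 : A k) a j].

Section Projection.
Variables (r : nat) (A : 'I_r -> comPzRingType) (I : ideal (product_ring A)).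
Variable i : 'I_r.

Definition proj_set : set (A i) :=
  [set a | exists2 x : product_ring A, ideal_set I x & x i = a].

Lemma proj_set0 : proj_set 0.
Proof. by exists 0; [apply: ideal0 | rewrite ffunE]. Qed.

Lemma proj_setD a b : proj_set a -> proj_set b -> proj_set (a + b).
Proof.
by move=> [x Ix <-] [y Iy <-]; exists (x + y); [apply: idealD | rewrite ffunE].
Qed.

Lemma proj_setMl a b : proj_set b -> proj_set (a * b).
Proof.
move=> [x Ix <-]; exists (inject a * x); first exact: idealMl.
by rewrite !ffunE dfwith_in.
Qed.

Definition proj_ideal : ideal (A i) := Ideal proj_set0 proj_setD proj_setMl.

(** Multiplying by the idempotent [inject 1] cuts a witness down to its i-th
    component without leaving the ideal. *)
Lemma inject_proj a : proj_set a -> ideal_set I (inject a).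
Proof.
move=> [x Ix <-]; suff -> : inject (x i) = inject (1 : A i) * x by apply: idealMl.
apply/ffunP => j; rewrite !ffunE.
by case: dfwithP => [|j' ne]; rewrite ?dfwith_in ?mul1r ?dfwith_out ?mul0r.
Qed.

End Projection.

Lemma product_ring_sum (r : nat) (A : 'I_r -> comPzRingType)
    (x : product_ring A) :
  x = \sum_i inject (x i).
Proof.
apply/ffunP => j.
have eval_sum (s : seq 'I_r) (F : 'I_r -> product_ring A) :
    (\sum_(i <- s) F i) j = \sum_(i <- s) F i j.
  by elim/big_rec2: _ => [|i y1 y2 _ <-]; rewrite ffunE.
rewrite eval_sum (bigD1 j) //= ffunE dfwith_in big1 ?addr0 // => i ne_ij.
by rewrite ffunE dfwith_out.
Qed.

Lemma principal_ring_product (r : nat) (A : 'I_r -> comPzRingType) :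
  (forall i, principal_ring (A i)) -> principal_ring (product_ring A).
Proof.
move=> prA; apply: principal_ring_intro => I.
have gen i := cid2 (principal_ring_gen (proj_ideal I i) (prA i)).
pose a : product_ring A := [ffun i => s2val (gen i)].
exists a.
  rewrite (product_ring_sum a); apply: ideal_sum => i.
  by apply: inject_proj; rewrite ffunE; exact: (s2valP (gen i)).
move=> x Ix.
have quo i : exists b, x i = b * a i.
  by rewrite ffunE; exact: (s2valP' (gen i) _ (ex_intro2 _ _ x Ix erefl)).
pose b : product_ring A := [ffun i => sval (cid (quo i))].
by exists b; apply/ffunP => i; rewrite [RHS]ffunE [b i]ffunE; case: (cid _).
Qed.

(** * Integers modulo n *)

(** The least positive integer d whose class lies in the ideal generates it:
    the remainder mod d of any representative is again in the ideal.  Since the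
    modulus has class 0, such a d exists even for the zero ideal. *)
Lemma principal_ring_Zp (n : nat) : principal_ring 'Z_n.
Proof.
apply: principal_ring_intro => I.
have exd : exists d : nat, (0 < d)%N && `[< ideal_set I d%:R >].
  exists (Zp_trunc n).+2; apply/asboolP.
  suff -> : (Zp_trunc n).+2%:R = 0 :> 'Z_n by exact: ideal0.
  by rewrite Zp_nat; apply: val_inj; apply: modnn.
case: (ex_minnP exd) => d /andP[d_gt0 /asboolP Id] d_min.
exists d%:R => // x Ix; exists (x %/ d)%:R.
have Irem : ideal_set I (x %% d)%:R.
  have -> : (x %% d)%:R = x - (x %/ d)%:R * d%:R :> 'Z_n.
    by rewrite -{2}[x]natr_Zp {2}(divn_eq x d) natrD natrM addrC addKr.
  by rewrite -mulNr; apply: idealD => //; apply: idealMl.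
have rem0 : (x %% d = 0)%N.
  apply/eqP; rewrite -leqn0 leqNgt; apply/negP => rem_gt0.
  have /d_min : (0 < x %% d)%N && `[< ideal_set I (x %% d)%:R >].
    by rewrite rem_gt0; apply/asboolP.
  by rewrite leqNgt ltn_mod d_gt0.
by rewrite -{1}[x]natr_Zp {1}(divn_eq x d) rem0 addn0 natrM.
Qed.

(** * Multiplication rings *)

Theorem theorem12 :
  (forall R : idomainType, principal_ideal_domain R -> multiplication_ring R) /\
  (forall (R : idomainType) (I : ideal R), principal_ideal_domain R ->
     multiplication_ring (quotient_ring I)) /\
  (forall (r : nat) (p alpha : 'I_r -> nat),
     (0 < r)%N ->
     (forall i, prime (p i)) ->
     (forall i, (0 < alpha i)%N) ->
     multiplication_ring (product_ring (fun i => 'Z_(p i ^ alpha i)))).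
Proof.
split=> [R|]; first exact: principal_ring_multiplication.
split=> [R I prR | r p alpha _ _ _]; apply: principal_ring_multiplication.
  exact: principal_ring_quotient.
by apply: principal_ring_product => i; apply: principal_ring_Zp.
Qed.
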